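(* Let $0 \neq f \in \mathbb{C}[x_0,\ldots,x_d]$ be a homogeneous form of degree $n$ and let $L = b_0 x_0 + \cdots + b_d x_d \in \mathbb{C}[x_0,\ldots,x_d]$ be a generic linear form. Let $F = x_0 x_1 \cdots x_d\, f$. Then the degree of the Gauss map $\nabla F$ equals the number of solutions in $D(F \cdot L)$ to the equations $$\frac{1}{x_i} + \frac{\partial_i f}{f} - (d+n+1)\, \frac{b_i}{L} = 0, \qquad i = 1,\ldots,d.$$
   Context: For a homogeneous polynomial $G \in \mathbb{C}[x_0,\ldots,x_d]$, $D(G) = \{x \in \mathbb{P}^d : G(x) \neq 0\}$. The notation $\partial_i f$ stands for $\frac{\partial f}{\partial x_i}$. The Gauss map is $\nabla F : D(F) \to \mathbb{P}^d$, $x \mapsto \left(\frac{\partial F}{\partial x_0}(x) : \cdots : \frac{\partial F}{\partial x_d}(x)\right)$, and its degree is the number of points in a generic fiber ($0$ if the map is not dominant). ''Generic linear form'' means that the statement holds for all $(b_0:\cdots:b_d)$ in some dense Zariski-open subset of $\mathbb{P}^d$. *)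

(* Defs.v *)
From mathcomp Require Import all_boot all_algebra.
From mathcomp Require Import boolp classical_sets cardinality reals.
From mathcomp Require Import complex.
From mathcomp Require Import mpoly.

Set Implicit Arguments.
Unset Strict Implicit.
Unset Printing Implicit Defensive.

Import GRing.Theory.

Local Open Scope classical_set_scope.
Local Open Scope card_scope.
Local Open Scope ring_scope.

Section ProjectiveSpace.
Variables (K : fieldType) (d : nat).

(* P^d as the set of lines of K^(d+1). *)
Definition proj := {U : {vspace 'rV[K]_d.+1} | \dim U == 1}.

Lemma dim_line1 : \dim <[const_mx 1 : 'rV[K]_d.+1]>%VS == 1.
Proof.
rewrite dim_vline; suff -> : (const_mx 1 : 'rV[K]_d.+1) != 0 by [].
by apply/eqP => /rowP/(_ 0); rewrite !mxE; apply/eqP/oner_neq0.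
Qed.

Definition proj1 : proj := Sub <[const_mx 1]>%VS dim_line1.

(* (x_0 : ... : x_d); this is the junk value proj1 when x = 0. *)
Definition pt (x : 'rV[K]_d.+1) : proj := insubd proj1 <[x]>%VS.

(* Some system of homogeneous coordinates of p.  The notions below do not
   depend on the choice: see D_pt and gauss_pt. *)
Definition hcoords (p : proj) : 'rV[K]_d.+1 := vpick (val p).

Lemma val_pt (x : 'rV[K]_d.+1) : x != 0 -> val (pt x) = <[x]>%VS.
Proof. by move=> x0; rewrite val_insubd dim_vline x0. Qed.

Lemma hcoords_neq0 (p : proj) : hcoords p != 0.
Proof. by rewrite vpick0 -dimv_eq0 (eqP (valP p)). Qed.

Lemma hcoordsK : cancel hcoords pt.
Proof.
move=> p; apply: val_inj; rewrite val_pt ?hcoords_neq0//.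
apply/eqP; rewrite eqEdim -memvE memv_pick dim_vline hcoords_neq0.
by rewrite (eqP (valP p)).
Qed.

Lemma hcoords_pt (x : 'rV[K]_d.+1) : x != 0 ->
  exists2 c : K, c != 0 & hcoords (pt x) = c *: x.
Proof.
move=> x0; have: hcoords (pt x) \in <[x]>%VS by rewrite -val_pt// memv_pick.
case/vlineP => c hc; exists c => //.
by apply/eqP => c0; have := hcoords_neq0 (pt x); rewrite hc c0 scale0r eqxx.
Qed.

Lemma pt_scale (c : K) (x : 'rV[K]_d.+1) :
  c != 0 -> x != 0 -> pt (c *: x) = pt x.
Proof.
move=> c0 x0; apply: val_inj; rewrite !val_pt ?scaler_eq0 ?negb_or ?c0//.
apply/eqP; rewrite eqEsubv -!memvE memvZ ?memv_line//=.
by rewrite -{1}[x](scalerK c0) memvZ ?memv_line.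
Qed.

Implicit Types (F G : {mpoly K[d.+1]}) (U : set proj).

(* hcoords p 0 : 'I_d.+1 -> K is the coordinate function of the row vector. *)
Definition D G : set proj := [set p | G.@[hcoords p 0] != 0].

Definition zariski_open U :=
  exists S : set {mpoly K[d.+1]},
    (forall G, S G -> exists m : nat, G \is m.-homog) /\
    U = \bigcup_(G in S) D G.

Definition zariski_dense U :=
  forall V : set proj, zariski_open V -> V !=set0 -> (U `&` V) !=set0.

Definition grad F (x : 'rV[K]_d.+1) : 'rV[K]_d.+1 :=
  \row_i (mderiv i F).@[x 0].

(* Only meaningful on D F; in characteristic 0, if F is homogeneous of positive
   degree, the gradient does not vanish there, by Euler's formula
   (grad_neq0). *)
Definition gauss F (p : proj) : proj := pt (grad F (hcoords p)).

Definition gauss_fiber F (y : proj) : set proj :=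
  D F `&` [set p | gauss F p = y].

Definition gauss_dominant F : Prop := zariski_dense (gauss F @` D F).

(* A generic fiber has k points.  As proj is irreducible when K is infinite,
   there is at most one such k. *)
Definition generic_fiber_card F (k : nat) : Prop :=
  exists U, [/\ zariski_open U, zariski_dense U &
                forall y, U y -> gauss_fiber F y #= `I_k].

(* The default value of xget is not a convention: for K algebraically closed of
   characteristic 0 and F homogeneous, a dominant Gauss map has finite generic
   fibers of constant cardinality. *)
Definition gauss_degree F : nat :=
  if `[< gauss_dominant F >] then xget 0%N [set k | generic_fiber_card F k]
  else 0%N.

Lemma mevalZ_homog m G (c : K) (x : 'rV[K]_d.+1) :
  G \is m.-homog -> G.@[(c *: x) 0] = c ^+ m * G.@[x 0].
Proof.
move/dhomogP => hG; rewrite !mevalE mulr_sumr big_seq [RHS]big_seq.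
apply: eq_bigr => a /hG /= <-; rewrite mulrCA; congr (_ * _).
rewrite mdegE -prodrXr -big_split /=.
by apply: eq_bigr => i _; rewrite mxE exprMn.
Qed.

Lemma mderiv_homog m G i : G \is m.+1.-homog -> mderiv i G \is m.-homog.
Proof.
move/dhomogP => hG; apply/dhomogP => a.
rewrite mcoeff_msupp mcoeff_deriv => h.
have /hG /= : (a + U_(i))%MM \in msupp G.
  by rewrite mcoeff_msupp; apply: contraNneq h => ->; rewrite mul0rn.
by rewrite mdegD mdeg1 addn1 => -[].
Qed.

Lemma euler m G (x : 'rV[K]_d.+1) : G \is m.-homog ->
  \sum_i x 0 i * (mderiv i G).@[x 0] = m%:R * G.@[x 0].
Proof.
move/dhomogP => hG.
have dG i : (mderiv i G).@[x 0] =
    \sum_(a <- msupp G) (mderiv i (G@_a *: 'X_[a])).@[x 0].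
  by rewrite {1}(mpolyE G) (raddf_sum (mderiv i)) raddf_sum.
under eq_bigr => i _ do rewrite dG mulr_sumr.
rewrite exchange_big mevalE mulr_sumr /= big_seq [RHS]big_seq.
apply: eq_bigr => a /hG /= <-.
rewrite mdegE natr_sum mulr_suml; apply: eq_bigr => i _.
rewrite mderivZ mderivX !mevalZ mevalX.
have [->|ai] := posnP (a i); first by rewrite !mul0r !mulr0.
rewrite mulrCA [RHS]mulrCA; congr (_ * _).
rewrite mulrCA; congr (_ * _).
rewrite (bigD1 i)//= [in RHS](bigD1 i)//= mulrA; congr (_ * _).
  by rewrite mnmBE mnm1E eqxx subn1 -exprS prednK.
by apply: eq_bigr => j ji; rewrite mnmBE mnm1E eq_sym (negPf ji) subn0.
Qed.

Lemma D_pt m G (x : 'rV[K]_d.+1) : G \is m.-homog -> x != 0 ->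
  D G (pt x) <-> G.@[x 0] != 0.
Proof.
move=> hG /hcoords_pt[c c0]; rewrite /D /= => ->.
by rewrite (mevalZ_homog _ _ hG) mulf_eq0 expf_eq0 (negPf c0) andbF.
Qed.

Lemma grad_neq0 m F (x : 'rV[K]_d.+1) : F \is m.-homog -> m%:R != 0 :> K ->
  F.@[x 0] != 0 -> grad F x != 0.
Proof.
move=> hF m0 Fx; apply/eqP => g0.
suff: m%:R * F.@[x 0] == 0 by rewrite mulf_eq0 (negPf m0) (negPf Fx).
rewrite -(euler x hF) big1// => i _.
by move/rowP: g0 => /(_ i); rewrite !mxE => ->; rewrite mulr0.
Qed.

Lemma gauss_pt m F (x : 'rV[K]_d.+1) : F \is m.-homog -> m%:R != 0 :> K ->
  x != 0 -> F.@[x 0] != 0 -> gauss F (pt x) = pt (grad F x).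
Proof.
case: m => [|m] hF m0 x0 Fx; first by rewrite eqxx in m0.
have [c c0 e] := hcoords_pt x0.
rewrite /gauss e -[RHS](@pt_scale (c ^+ m)) ?expf_neq0 ?(grad_neq0 hF)//.
congr pt; apply/rowP => i; rewrite !mxE.
exact: mevalZ_homog (mderiv_homog i hF).
Qed.

Definition coord_prod : {mpoly K[d.+1]} := \prod_(i < d.+1) 'X_i.

Definition linform (b : 'rV[K]_d.+1) : {mpoly K[d.+1]} :=
  \sum_(i < d.+1) b 0 i *: 'X_i.

(* The equations are homogeneous of degree -1 in x, and every denominator is
   nonzero on D(F L). *)
Definition solutions (n : nat) (f : {mpoly K[d.+1]}) (b : 'rV[K]_d.+1) :
    set proj :=
  [set p | D (coord_prod * f * linform b) p /\
    let x := hcoords p in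
    forall i : 'I_d.+1, i != 0 ->
      1 / x 0 i + (mderiv i f).@[x 0] / f.@[x 0]
        - (d + n + 1)%N%:R * (b 0 i / (linform b).@[x 0]) = 0].

End ProjectiveSpace.

(* Main.v *)
Require Import Defs.
From mathcomp Require Import all_boot all_algebra closed_field.
From mathcomp Require Import boolp classical_sets cardinality reals.
From mathcomp Require Import complex.
From mathcomp Require Import mpoly ring.

(** The system of equations is the fiber of the Gauss map over b in disguise.
    Write F = x_0 ... x_d f and N = d + n + 1 = deg F.  Its logarithmic
    derivatives are d_i F / F = 1/x_i + d_i f / f, so the i-th equation says
    d_i F (x) = (N F(x) / L(x)) b_i.  The equation of index 0 is missing, but
    Euler's formula sum_i x_i d_i F = N F recovers it from the others because
    x_0 <> 0; hence a solution satisfies (d_i F (x))_i = c b with c <> 0.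
    Conversely grad F (x) = c b forces N F(x) = c L(x), again by Euler, so that
    L(x) <> 0 and c = N F(x) / L(x).  Thus [solutions_gauss_fiber] holds for
    every nonzero b, without genericity.

    It remains to see that a generic fiber of the Gauss map has gauss_degree F
    points ([generic_gauss_fiber_card]).  The degree is defined by choosing
    some k such that generic fibers have k points, so the content is the
    existence of k.  By homogeneity, every line of the fiber over the class of y
    contains exactly one x with d_i F (x) = y_i F (x) for all i
    ([gauss_fiberE]), so the question concerns the fibers of the affine
    rational map x |-> (d_i F (x) / F (x))_i, and the argument applies to any
    rational map (q_i / F)_i from an affine space to an affine space of the
    same dimension, over an algebraically closed field.

    - Generic fibers are finite, of bounded size ([fiber_bounded]): a count of
      monomials shows that the N + 1 rational functions x_j, q_1/F, ..., q_N/F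
      in N variables satisfy a polynomial relation, so over a generic y the
      coordinate x_j of a point of the fiber is a root of a fixed nonzero
      polynomial of bounded degree.
    - For each k, the fiber either generically has k distinct points or
      generically does not ([has_points_dichotomy]).  This property of y is a
      first-order formula in the language of rings; by quantifier elimination it
      is a boolean combination of polynomial equations in y, and each of these
      is generically true or generically false.

    The largest k for which the generic fiber has k distinct points is then the
    exact generic number ([generic_fiber_count]).  If k > 0, the image of the
    Gauss map contains a dense open set; so k = 0 when the map is not dominant,
    in agreement with the convention for the degree. *)

Set Implicit Arguments.
Unset Strict Implicit.
Unset Printing Implicit Defensive.

Import GRing.Theory.

Local Open Scope classical_set_scope.
Local Open Scope card_scope.
Local Open Scope ring_scope.

(** * Specializing all variables but the last *)

Section LastVariable.
Variables (K : fieldType) (n : nat).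
Implicit Type p : {mpoly K[n.+1]}.

Definition extend (v : 'I_n -> K) (x : K) (i : 'I_n.+1) : K :=
  if unlift ord_max i is Some j then v j else x.

Lemma widen_lift_max (i : 'I_n) : widen_ord (leqnSn n) i = lift ord_max i.
Proof. by apply: val_inj; rewrite /= /bump leqNgt ltn_ord. Qed.

Lemma meval_extend p v x :
  p.@[extend v x] = (map_poly (meval v) (muni p)).[x].
Proof.
rewrite muniE rmorph_sum /= horner_sum mevalE; apply: eq_bigr => m _.
rewrite -mul_polyC rmorphM /= map_polyC map_polyXn hornerM hornerC hornerXn.
rewrite big_ord_recr /= mevalZ mevalX mulrA /extend unlift_none.
congr (_ * _ * _); apply: eq_bigr => i _.
by rewrite mnmE widen_lift_max liftK.
Qed.

Lemma muni_neq0 p : p != 0 -> muni p != 0.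
Proof.
pose low (m : 'X_{1..n.+1}) :=
  [multinom m (widen_ord (leqnSn n) i) | i < n].
move=> p0; set m := mlead p.
have mp : m \in msupp p by exact: mlead_supp.
apply: contraTneq mp => up0; rewrite mcoeff_msupp negbK.
have : ((muni p)`_(m ord_max))@_(low m) == 0 by rewrite up0 coef0 mcoeff0.
rewrite muniE coef_sum raddf_sum /=.
have E m' : (p@_m' *: 'X_[low m'] *: 'X^(m' ord_max))`_(m ord_max)@_(low m) =
    p@_m' * (m' == m)%:R.
  rewrite coefZ coefXn mulr_natr mcoeffMn mcoeffZ mcoeffX -mulrnAr -mulr_natr.
  rewrite -natrM mulnb; congr (_ * _%:R).
  have [->|ne] := eqVneq m' m; first by rewrite !eqxx.
  apply/eqP; rewrite eqb0; apply: contra ne => /andP[/eqP e1 /eqP e2].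
  apply/eqP/mnmP => i; have [j ->|->] := unliftP ord_max i; last by rewrite e2.
  by move/mnmP: e1 => /(_ j); rewrite !mnmE widen_lift_max.
under eq_bigr => m' _ do rewrite E.
case: (boolP (m \in msupp p)) => [mp|/memN_msupp_eq0 ->]; last by rewrite eqxx.
rewrite (bigD1_seq m) ?msupp_uniq //= eqxx mulr1 big1 ?addr0 // => m' /negPf ->.
by rewrite mulr0.
Qed.

Lemma map_meval_neq0 (v : 'I_n -> K) (p : {poly {mpoly K[n]}}) :
  (lead_coef p).@[v] != 0 -> map_poly (meval v) p != 0.
Proof.
apply: contra => /eqP/polyP/(_ (size p).-1).
by rewrite coef_map coef0 => /eqP.
Qed.

End LastVariable.

Lemma meval_nonvanishing (K : closedFieldType) n (p : {mpoly K[n]}) :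
  p != 0 -> exists v : 'I_n -> K, p.@[v] != 0.
Proof.
elim: n p => [|n IHn] p p0.
  exists (fun=> 0); suff -> : p = (mcoeff 0%MM p)%:MP.
    rewrite mevalC; apply: contra p0 => /eqP c0; apply/eqP/mpolyP => m.
    suff -> : m = 0%MM by rewrite mcoeff0.
    by apply/mnmP => -[].
  apply/mpolyP => m; have -> : m = 0%MM by apply/mnmP => -[].
  by rewrite mcoeffC eqxx mulr1.
have /IHn[v pv] : lead_coef (muni p) != 0 by rewrite lead_coef_eq0 muni_neq0.
have /closed_nonrootP[x px] := map_meval_neq0 pv.
by exists (extend v x); rewrite meval_extend.
Qed.

(** * Algebraic dependence of N + 1 rational functions in N variables *)

Section AlgebraicDependence.
Variables (K : fieldType) (N : nat).

Lemma msizeM_leq a b (p q : {mpoly K[N]}) :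
  (msize p <= a.+1)%N -> (msize q <= b.+1)%N -> (msize (p * q) <= (a + b).+1)%N.
Proof.
move=> pa qb.
have [->|p0] := eqVneq p 0; first by rewrite mul0r msize0.
have [->|q0] := eqVneq q 0; first by rewrite mulr0 msize0.
rewrite msizeM // -ltnS prednK; last by rewrite addn_gt0 lt0n msize_poly_eq0 p0.
by rewrite (leq_trans (leq_add pa qb)) // addSn addnS.
Qed.

Lemma msizeX_leq a k (p : {mpoly K[N]}) :
  (msize p <= a.+1)%N -> (msize (p ^+ k) <= (k * a).+1)%N.
Proof.
move=> pa; elim: k => [|k IHk]; first by rewrite expr0 msize1.
by rewrite exprS mulSn msizeM_leq.
Qed.

Lemma msize_prod_leq (I : finType) a (p : I -> {mpoly K[N]}) :
  (forall i, msize (p i) <= a.+1)%N -> (msize (\prod_i p i) <= (#|I| * a).+1)%N.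
Proof.
move=> pa; rewrite -big_enum cardE /=; elim: (enum I) => [|i s IHs].
  by rewrite big_nil msize1.
by rewrite big_cons mulSn msizeM_leq.
Qed.

(** Exponents confined to a box form a finite type, which makes it possible to
    count monomials without binomial coefficients. *)
Definition box_mnm r B (a : {ffun 'I_r -> 'I_B}) : 'X_{1..r} :=
  [multinom (a i : nat) | i < r].

Lemma box_mnm_inj r B : injective (@box_mnm r B).
Proof.
move=> a b /mnmP e; apply/ffunP => i; apply: val_inj.
by have := e i; rewrite !mnmE.
Qed.

Lemma box_mnm_surj r B (m : 'X_{1..r}) :
  (mdeg m < B)%N -> exists a : {ffun 'I_r -> 'I_B}, m = box_mnm a.
Proof.
move=> mB; have mi i : (m i < B)%N.
  by apply: leq_ltn_trans mB; rewrite mdegE (bigD1 i) //= leq_addr.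
by exists [ffun i => Ordinal (mi i)]; apply/mnmP => i; rewrite mnmE ffunE.
Qed.

(** The monomials in q_i / F with exponents less than D, multiplied by a common
    power of F, are D ^ (N + 1) polynomials whose degree is linear in D.  They
    live in a space whose dimension grows as D ^ N, hence they are linearly
    dependent for D large, and a linear relation between them is the polynomial
    relation G.  Stating it by values at points avoids the field of fractions. *)
Lemma rational_functions_dependent (F : {mpoly K[N]})
    (q : 'I_N.+1 -> {mpoly K[N]}) :
  exists2 G : {mpoly K[N.+1]}, G != 0 &
    forall (x : 'I_N -> K) (t : 'I_N.+1 -> K), F.@[x] != 0 ->
      (forall i, (q i).@[x] = t i * F.@[x]) -> G.@[t] = 0.
Proof.
pose C := (msize F + \sum_i msize (q i))%N.
have FC : (msize F <= C.+1)%N by rewrite leqW // leq_addr.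
have qC i : (msize (q i) <= C.+1)%N.
  by rewrite leqW // (leq_trans _ (leq_addl _ _)) // (bigD1 i) //= leq_addr.
(* The least D for which D ^ (N + 1) exceeds the bound (((N + 1) C + 1) D) ^ N
   on the number of monomials available to the polynomials Q below. *)
pose D := ((N.+1 * C).+1 ^ N).+1.
pose M := (N.+1 * (D * C)).+1.
pose Q (a : {ffun 'I_N.+1 -> 'I_D}) :=
  \prod_i (q i ^+ a i * F ^+ (D - a i)).
have Qsize a : (msize (Q a) <= M)%N.
  have := @msize_prod_leq _ (D * C) (fun i => q i ^+ a i * F ^+ (D - a i)).
  rewrite card_ord; apply => i.
  have -> : (D * C = a i * C + (D - a i) * C)%N.
    by rewrite -mulnDl subnKC // ltnW.
  by apply: msizeM_leq; apply: msizeX_leq.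
pose A := \matrix_(a < #|{: {ffun 'I_N.+1 -> 'I_D}}|,
  b < #|{: {ffun 'I_N -> 'I_M}}|) (Q (enum_val a))@_(box_mnm (enum_val b)).
have [v v0 vA] : exists2 v : 'rV_#|{: {ffun 'I_N.+1 -> 'I_D}}|,
    v != 0 & v *m A = 0.
  have /rowV0Pn[v /sub_kermxP vA v0] : kermx A != 0; last by exists v.
  rewrite kermx_eq0 -row_leq_rank -ltnNge (leq_ltn_trans (rank_leq_col A)) //.
  rewrite !card_ffun !card_ord.
  have MD : (M <= (N.+1 * C).+1 * D)%N.
    by rewrite /M [leqRHS]mulSn -mulnA [(C * D)%N]mulnC -add1n leq_add2r.
  apply: (@leq_ltn_trans (((N.+1 * C).+1 * D) ^ N)%N).
    by have [->|N0] := posnP N; rewrite ?expn0 // leq_exp2r.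
  by rewrite expnMn expnS ltn_pmul2r // expn_gt0.
pose G := \sum_a v 0 a *: 'X_[K, box_mnm (enum_val a)].
have GE a : G@_(box_mnm (enum_val a)) = v 0 a.
  rewrite raddf_sum (bigD1 a) //= mcoeffZ mcoeffX eqxx mulr1 big1 ?addr0 //.
  move=> b ba; rewrite mcoeffZ mcoeffX; case: eqP; rewrite ?mulr0 //.
  by move=> /box_mnm_inj/enum_val_inj e; rewrite e eqxx in ba.
exists G.
  have /rV0Pn[a va] := v0.
  by apply: contra va => /eqP G0; rewrite -GE G0 mcoeff0.
have sumQ : \sum_a v 0 a *: Q (enum_val a) = 0.
  apply/mpolyP => m; rewrite mcoeff0 raddf_sum /=.
  have [mM|Mm] := ltnP (mdeg m) M; last first.
    rewrite big1 // => a _; rewrite mcoeffZ memN_msupp_eq0 ?mulr0 //.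
    by rewrite msize_mdeg_ge // (leq_trans _ Mm).
  have [b ->] := box_mnm_surj mM.
  move/rowP: vA => /(_ (enum_rank b)); rewrite !mxE => vAb; rewrite -[RHS]vAb.
  by apply: eq_bigr => a _; rewrite mcoeffZ mxE enum_rankK.
move=> x t Fx qx.
have QE a : (Q a).@[x] = 'X_[K, box_mnm a].@[t] * F.@[x] ^+ (N.+1 * D).
  have -> : F.@[x] ^+ (N.+1 * D) = \prod_(i < N.+1) F.@[x] ^+ D.
    by rewrite prodr_const card_ord -exprM mulnC.
  rewrite rmorph_prod /=.
  rewrite mevalX -big_split /=; apply: eq_bigr => i _.
  rewrite rmorphM !rmorphXn /= qx exprMn -mulrA -exprD mnmE subnKC //.
  exact: ltnW.
have : (\sum_a v 0 a *: Q (enum_val a)).@[x] = 0 by rewrite sumQ meval0.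
have -> : (\sum_a v 0 a *: Q (enum_val a)).@[x] =
    G.@[t] * F.@[x] ^+ (N.+1 * D).
  rewrite !rmorph_sum /= mulr_suml; apply: eq_bigr => a _.
  by rewrite !mevalZ QE mulrA.
by move/eqP; rewrite mulf_eq0 expf_eq0 (negPf Fx) andbF orbF => /eqP.
Qed.

End AlgebraicDependence.

(** * Finiteness of generic fibers *)

Section Generic.
Variables (K : closedFieldType) (N : nat).
Implicit Types P Q : 'rV[K]_N -> Prop.

(** P holds on a nonempty principal open set; as the affine space is
    irreducible, these sets have the finite intersection property. *)
Definition generically P :=
  exists2 H : {mpoly K[N]}, H != 0 & forall y : 'rV_N, H.@[y 0] != 0 -> P y.

Lemma generically_imp P Q : (forall y, P y -> Q y) ->
  generically P -> generically Q.
Proof. by move=> PQ [H H0 HP]; exists H => // y /HP/PQ. Qed.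

Lemma generically_and P Q :
  generically P -> generically Q -> generically (fun y => P y /\ Q y).
Proof.
move=> [H H0 HP] [G G0 GQ]; exists (H * G); first by rewrite mulf_neq0.
by move=> y; rewrite mevalM mulf_eq0 negb_or => /andP[/HP Py /GQ Qy].
Qed.

Lemma generically_exists P : generically P -> exists y, P y.
Proof.
move=> [H /meval_nonvanishing[v Hv] HP]; exists (\row_i v i); apply: HP.
by rewrite (@meval_eq _ _ _ v) // => i; rewrite mxE.
Qed.

Lemma generically_forall (I : finType) (P : I -> 'rV[K]_N -> Prop) :
  (forall i, generically (P i)) -> generically (fun y => forall i, P i y).
Proof.
move=> gP; have /choice[H HP] : forall i, exists H : {mpoly K[N]},
    H != 0 /\ forall y : 'rV_N, H.@[y 0] != 0 -> P i y.
  by move=> i; have [H H0 HP] := gP i; exists H.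
exists (\prod_i H i); first by apply/prodf_neq0 => i _; have [] := HP i.
move=> y; rewrite rmorph_prod => /prodf_neq0 Hy i.
by have [_] := HP i; apply; apply: Hy.
Qed.

End Generic.

Section FiniteFibers.
Variables (K : closedFieldType) (N : nat).
Variables (F : {mpoly K[N]}) (q : 'I_N -> {mpoly K[N]}).

(** The fiber over y of the rational map (q_i / F)_i, with the denominator
    cleared. *)
Definition in_fiber (y x : 'rV[K]_N) : bool :=
  (F.@[x 0] != 0) && [forall i, (q i).@[x 0] == y 0 i * F.@[x 0]].

(** The rational functions q_1/F, ..., q_N/F and x_j satisfy a relation G.  Seen
    as a polynomial in its last variable, G specializes at a generic y to a
    nonzero polynomial of which x_j is a root, for every x in the fiber.  This
    includes the case where x_j does not occur in G: a generic fiber is then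
    empty. *)
Lemma fiber_coordinate_finite (j : 'I_N) : exists S, generically (fun y =>
  exists2 r : seq K, (size r <= S)%N & forall x, in_fiber y x -> x 0 j \in r).
Proof.
pose qj (i : 'I_N.+1) := if unlift ord_max i is Some i' then q i' else 'X_j * F.
have [G G0 Gq] := rational_functions_dependent F qj.
set p := muni G; have p0 : p != 0 by exact: muni_neq0.
exists (size p); exists (lead_coef p); first by rewrite lead_coef_eq0.
move=> y /map_meval_neq0; set py := map_poly _ p => py0.
have [r rE] := closed_field_poly_normal py.
exists r.
  have rp : (size r).+1 = size py.
    by rewrite [in RHS]rE size_scale ?size_prod_XsubC // lead_coef_eq0.
  by rewrite ltnW // rp size_poly.
move=> x /andP[Fx /forallP qx].
suff : root py (x 0 j) by rewrite rE rootZ ?lead_coef_eq0 // root_prod_XsubC.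
rewrite rootE -meval_extend; apply/eqP; apply: (Gq (x 0)) => // i.
rewrite /qj /extend; case: unlift => [i'|]; first exact/eqP.
by rewrite mevalM mevalXU.
Qed.

(** A point of the fiber is determined by choosing each coordinate in a list of
    bounded length. *)
Lemma fiber_bounded : exists B, generically (fun y =>
  forall s, uniq s -> all (in_fiber y) s -> (size s <= B)%N).
Proof.
have /choice[S HS] := fiber_coordinate_finite.
pose M := \max_j S j.
exists #|{: {ffun 'I_N -> 'I_M}}|.
apply: generically_imp (generically_forall HS) => y Hy s us /allP sy.
have /choice[r Hr] : forall j, exists r : seq K,
    (size r <= M)%N /\ forall x, in_fiber y x -> x 0 j \in r.
  move=> j; have [r rS Hr] := Hy j; exists r; split => //.
  exact: leq_trans rS (leq_bigmax j).
rewrite cardE -(size_map (fun g : {ffun 'I_N -> 'I_M} => \row_j (r j)`_(g j))).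
apply: uniq_leq_size us _ => x /sy xy.
have xr (j : 'I_N) : (index (x ord0 j) (r j) < M)%N.
  by have [rM rx] := Hr j; rewrite (leq_trans _ rM) // index_mem rx.
apply/mapP; exists [ffun j => Ordinal (xr j)]; first by rewrite mem_enum.
apply/rowP => j; rewrite mxE ffunE nth_index //.
by have [_] := Hr j; apply.
Qed.

End FiniteFibers.

(** * Counting the points of a fiber in the language of rings *)

Section Environments.
Variables (K : fieldType) (n : nat).

(** The formulas below speak of several points of K^(n+1), encoded one after
    another in a single valuation: coordinate i of the point j is the variable
    of index j (n + 1) + i. *)
Definition env (s : seq 'rV[K]_n.+1) : seq K :=
  mkseq (fun a => s`_(a %/ n.+1)%N 0 (inord (a %% n.+1)%N)) (size s * n.+1)%N.

Definition block (e : seq K) (j : nat) : 'rV[K]_n.+1 :=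
  \row_i e`_(j * n.+1 + i)%N.

Lemma nth_env (s : seq 'rV[K]_n.+1) a :
  (env s)`_a = s`_(a %/ n.+1)%N 0 (inord (a %% n.+1)%N).
Proof.
have [lt_a|le_a] := ltnP a (size s * n.+1)%N; first by rewrite nth_mkseq.
by rewrite !nth_default ?size_mkseq ?mxE // leq_divRL.
Qed.

Lemma block_env (s : seq 'rV[K]_n.+1) j : block (env s) j = s`_j.
Proof.
apply/rowP => i; rewrite mxE nth_env divnMDl // divn_small // addn0.
by rewrite modnMDl modn_small // inord_val.
Qed.

Lemma eq_block e e' j :
  (forall a, (a %/ n.+1)%N = j -> e`_a = e'`_a) -> block e j = block e' j.
Proof.
move=> ee'; apply/rowP => i; rewrite !mxE ee' //.
by rewrite divnMDl // divn_small // addn0.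
Qed.

End Environments.

Section Terms.
Variables (K : fieldType) (n : nat).

(** The value at the inverse is arbitrary: quantifier elimination only produces
    terms without inverses. *)
Fixpoint term_mpoly (t : GRing.term K) : {mpoly K[n.+1]} :=
  match t with
  | GRing.Var a => if (a < n.+1)%N then 'X_(inord a) else 0
  | GRing.Const c => c%:MP
  | GRing.NatConst k => k%:R
  | GRing.Add t1 t2 => term_mpoly t1 + term_mpoly t2
  | GRing.Opp t1 => - term_mpoly t1
  | GRing.NatMul t1 k => term_mpoly t1 *+ k
  | GRing.Mul t1 t2 => term_mpoly t1 * term_mpoly t2
  | GRing.Inv _ => 0
  | GRing.Exp t1 k => term_mpoly t1 ^+ k
  end.

Lemma eval_term_mpoly (y : 'rV[K]_n.+1) t : GRing.rterm t ->
  GRing.eval (env [:: y]) t = (term_mpoly t).@[y 0].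
Proof.
elim: t => //=.
- move=> a _; rewrite nth_env.
  have [lt_a|le_a] := ltnP a n.+1.
    by rewrite divn_small // modn_small // mevalXU.
  rewrite meval0 nth_default ?mxE //=.
  by rewrite divn_gt0.
- by move=> c _; rewrite mevalC.
- by move=> k _; rewrite rmorph_nat.
- by move=> t1 IH1 t2 IH2 /andP[/IH1 -> /IH2 ->]; rewrite mevalD.
- by move=> t IH /IH ->; rewrite mevalN.
- by move=> t IH k /IH ->; rewrite mevalMn.
- by move=> t1 IH1 t2 IH2 /andP[/IH1 -> /IH2 ->]; rewrite mevalM.
- by move=> t IH k /IH ->; rewrite rmorphXn.
Qed.

Definition mpoly_term (j : nat) (p : {mpoly K[n.+1]}) : GRing.term K :=
  foldr (fun m t => GRing.Add (GRing.Mul (GRing.Const p@_m)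
     (foldr (fun (i : 'I_n.+1) u =>
          GRing.Mul (GRing.Exp (GRing.Var _ (j * n.+1 + i)%N) (m i)) u)
        (GRing.Const 1) (enum 'I_n.+1))) t)
    (GRing.Const 0) (msupp p).

Lemma eval_mpoly_term e j p : GRing.eval e (mpoly_term j p) = p.@[block n e j 0].
Proof.
rewrite mevalE /mpoly_term; elim: (msupp p) => [|m s IHs] /=.
  by rewrite big_nil.
rewrite big_cons IHs; congr (_ * _ + _).
rewrite -big_enum /=; elim: (enum _) => [|i r IHr] /=; first by rewrite big_nil.
by rewrite big_cons IHr mxE.
Qed.

Lemma rterm_mpoly_term j p : GRing.rterm (mpoly_term j p).
Proof.
rewrite /mpoly_term; elim: (msupp p) => //= m s ->; rewrite andbT.
by elim: (enum _).
Qed.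

Definition conj_formula (I : finType) (f : I -> GRing.formula K) :=
  foldr (fun i => GRing.And (f i)) (GRing.Bool true) (enum I).

Lemma holds_conj (I : finType) (f : I -> GRing.formula K) e :
  GRing.holds e (conj_formula f) <-> forall i, GRing.holds e (f i).
Proof.
have -> : (forall i, GRing.holds e (f i)) <->
          (forall i, i \in enum I -> GRing.holds e (f i)).
  by split=> H i; [move=> _|]; apply: H; rewrite // mem_enum.
rewrite /conj_formula; elim: (enum I) => [|i s IHs] //=.
split=> [[fi /IHs fs] k|H].
  by rewrite in_cons => /predU1P[-> //|]; apply: fs.
split; first by apply: H; rewrite mem_head.
by apply/IHs => k ks; apply: H; rewrite in_cons ks orbT.
Qed.

Lemma rformula_conj (I : finType) (f : I -> GRing.formula K) :
  (forall i, GRing.rformula (f i)) -> GRing.rformula (conj_formula f).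
Proof.
move=> rf; rewrite /conj_formula.
by elim: (enum I) => //= i s ->; rewrite rf.
Qed.

End Terms.

Section QuantifierElimination.
Variables (K : closedFieldType) (n : nat).

(** An atom is the vanishing of a polynomial in y: it holds everywhere if that
    polynomial is zero and fails generically otherwise.  Connectives preserve
    the dichotomy because generic properties are closed under conjunction. *)
Lemma qf_formula_dichotomy (f : GRing.formula K) :
  GRing.qf_form f -> GRing.rformula f ->
  generically (fun y : 'rV[K]_n.+1 => GRing.qf_eval (env [:: y]) f) \/
  generically (fun y : 'rV[K]_n.+1 => ~~ GRing.qf_eval (env [:: y]) f).
Proof.
have gen_all (P : 'rV[K]_n.+1 -> Prop) : (forall y, P y) -> generically P.
  by move=> HP; exists 1 => //; apply: oner_neq0.
elim: f => //=.
- by case=> _ _; [left|right]; apply: gen_all.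
- move=> t1 t2 _ /andP[r1 r2].
  have [e12|ne12] := eqVneq (term_mpoly n t1 - term_mpoly n t2) 0.
    left; apply: gen_all => y; rewrite !eval_term_mpoly // -subr_eq0 -mevalB.
    by rewrite e12 meval0.
  right; exists (term_mpoly n t1 - term_mpoly n t2) => // y.
  by rewrite mevalB subr_eq0 !eval_term_mpoly.
- move=> f1 IH1 f2 IH2 /andP[q1 q2] /andP[r1 r2].
  have [g1|g1] := IH1 q1 r1; last first.
    by right; apply: generically_imp g1 => y /negPf ->.
  have [g2|g2] := IH2 q2 r2; last first.
    by right; apply: generically_imp g2 => y /negPf ->; rewrite andbF.
  by left; apply: generically_imp (generically_and g1 g2) => y [-> ->].
- move=> f1 IH1 f2 IH2 /andP[q1 q2] /andP[r1 r2].
  have [g1|g1] := IH1 q1 r1; first by left; apply: generically_imp g1 => y ->.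
  have [g2|g2] := IH2 q2 r2.
    by left; apply: generically_imp g2 => y ->; rewrite orbT.
  right; apply: generically_imp (generically_and g1 g2) => y [].
  by move=> /negPf -> /negPf ->.
- move=> f1 IH1 f2 IH2 /andP[q1 q2] /andP[r1 r2].
  have [g1|g1] := IH1 q1 r1; last first.
    by left; apply: generically_imp g1 => y /negPf ->.
  have [g2|g2] := IH2 q2 r2.
    by left; apply: generically_imp g2 => y ->; rewrite implybT.
  right; apply: generically_imp (generically_and g1 g2) => y [].
  by move=> -> /negPf ->.
- move=> f IH qf rf; have [g|g] := IH qf rf; [right|by left].
  by apply: generically_imp g => y ->.
Qed.

(** Chevalley's theorem, in the form of the elimination of quantifiers over
    algebraically closed fields, reduces to formulas without quantifiers. *)
Lemma formula_dichotomy (f : GRing.formula K) : GRing.rformula f ->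
  generically (fun y : 'rV[K]_n.+1 => GRing.holds (env [:: y]) f) \/
  generically (fun y : 'rV[K]_n.+1 => ~ GRing.holds (env [:: y]) f).
Proof.
move=> rf; have okQE := ClosedFieldQE.holds_ex_elim (@GRing.solve_monicpoly K).
have wfQE := @ClosedFieldQE.wf_ex_elim K.
have /andP[qg rg] := GRing.quantifier_elim_wf wfQE rf.
have QE e := GRing.quantifier_elim_rformP wfQE okQE e rf.
have [g|g] := qf_formula_dichotomy qg rg; [left|right].
  by apply: generically_imp g => y /QE.
by apply: generically_imp g => y; apply: contraNnot => /QE.
Qed.

End QuantifierElimination.

Section FiberCount.
Variables (K : closedFieldType) (n : nat).
Variables (F : {mpoly K[n.+1]}) (q : 'I_n.+1 -> {mpoly K[n.+1]}).

Definition has_points k (y : 'rV[K]_n.+1) : Prop :=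
  exists s, [/\ size s = k, uniq s & all (in_fiber F q y) s].

Definition fiber_formula j : GRing.formula K :=
  GRing.And (GRing.Not (GRing.Equal (mpoly_term j F) (GRing.Const 0)))
    (conj_formula (fun i => GRing.Equal (mpoly_term j (q i))
       (GRing.Mul (GRing.Var _ i) (mpoly_term j F)))).

Lemma holds_fiber_formula e j :
  GRing.holds e (fiber_formula j) <-> in_fiber F q (block n e 0) (block n e j).
Proof.
rewrite /= holds_conj /= eval_mpoly_term /in_fiber.
split=> [[/eqP -> H]|/andP[/eqP F0 /forallP H]] /=.
  apply/forallP => i; by rewrite -eval_mpoly_term H mxE.
by split=> // i; rewrite eval_mpoly_term (eqP (H i)) mxE.
Qed.

Definition distinct_formula j l : GRing.formula K :=
  GRing.Not (conj_formula (fun i : 'I_n.+1 =>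
    GRing.Equal (GRing.Var K (j * n.+1 + i)%N) (GRing.Var _ (l * n.+1 + i)%N))).

Lemma holds_distinct_formula e j l :
  GRing.holds e (distinct_formula j l) <-> block n e j != block n e l.
Proof.
rewrite /= holds_conj /=; split=> [H|/eqP H E].
  by apply/eqP => /rowP E; apply: H => i; have := E i; rewrite !mxE.
by apply: H; apply/rowP => i; rewrite !mxE.
Qed.

(** Block 0 of the valuation is y; blocks 1 to k are the bound points. *)
Definition count_formula k : GRing.formula K :=
  foldr GRing.Exists
   (GRing.And
     (conj_formula (fun j : 'I_k => fiber_formula j.+1))
     (conj_formula (fun p : 'I_k * 'I_k =>
        if p.1 == p.2 then GRing.Bool true
        else distinct_formula p.1.+1 p.2.+1)))
   (iota n.+1 (k * n.+1)%N).

Lemma rformula_count k : GRing.rformula (count_formula k).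
Proof.
rewrite /count_formula; elim: (iota _ _) => //=; apply/andP; split.
  apply: rformula_conj => j /=; rewrite rterm_mpoly_term /=.
  by apply: rformula_conj => i /=; rewrite !rterm_mpoly_term.
by apply: rformula_conj => -[j l] /=; case: ifP => //= _; apply: rformula_conj.
Qed.

Lemma holds_count k (y : 'rV[K]_n.+1) :
  GRing.holds (env [:: y]) (count_formula k) <-> has_points k y.
Proof.
rewrite /count_formula; split.
  move=> /GRing.foldExistsP[e ey [/holds_conj fib /holds_conj dis]].
  have e0 : block n e 0 = y.
    rewrite -[RHS](block_env [:: y] 0); apply: eq_block => a a0.
    rewrite ey // !inE mem_iota negb_and -ltnNge.
    by rewrite (divn_eq a n.+1) a0 mul0n add0n ltn_mod.
  exists (mkseq (fun j => block n e j.+1) k); split; first exact: size_mkseq.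
    rewrite map_inj_in_uniq ?iota_uniq // => j l.
    rewrite !mem_iota !add0n => /= jk lk.
    have := dis (Ordinal jk, Ordinal lk) => /=; case: eqP => [[]//|_].
    by move/holds_distinct_formula/eqP.
  apply/allP => x /mapP[j]; rewrite mem_iota => /= jk ->.
  by rewrite -[y]e0; apply/holds_fiber_formula; apply: (fib (Ordinal jk)).
move=> [s [sk us /allP sF]]; apply/GRing.foldExistsP; exists (env (y :: s)).
  move=> a; rewrite !inE mem_iota !nth_env.
  have [lt_a _|le_a] := ltnP a n.+1; first by rewrite divn_small.
  rewrite -leqNgt -mulSn -leq_divRL // => ka.
  by rewrite !nth_default //= ?sk // (leq_trans _ ka).
split; apply/holds_conj.
  move=> j; apply/holds_fiber_formula; rewrite !block_env /=.
  by apply/sF/mem_nth; rewrite sk.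
move=> [j l] /=; case: eqP => // /eqP jl; apply/holds_distinct_formula.
by rewrite !block_env /= nth_uniq // sk.
Qed.

Lemma has_points_dichotomy k :
  generically (has_points k) \/ generically (fun y => ~ has_points k y).
Proof.
have [g|g] := formula_dichotomy n (rformula_count k); [left|right];
  apply: generically_imp g => y; first by move/holds_count.
by move=> nh /holds_count.
Qed.

(** Generically the fiber has at least 0 points and, by [fiber_bounded], not
    B + 1 of them; the dichotomy leaves a k at which generic truth stops. *)
Lemma generic_fiber_count : exists k, generically (fun y =>
  exists s, [/\ size s = k, uniq s & forall x, (x \in s) = in_fiber F q y x]).
Proof.
have [B gB] := fiber_bounded F q.
have [k gk gSk] : exists2 k, generically (has_points k) &
    generically (fun y => ~ has_points k.+1 y).
  apply: contrapT => no_jump.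
  have g k : generically (has_points k).
    elim: k => [|k IHk]; first by exists 1; [exact: oner_neq0|exists [::]].
    have [//|gSk] := has_points_dichotomy k.+1.
    by case: no_jump; exists k.
  have [y [bound [s [sB us sF]]]] :=
    generically_exists (generically_and gB (g B.+1)).
  by have := bound s us sF; rewrite sB ltnn.
exists k; apply: generically_imp (generically_and gk gSk).
move=> y [[s [sk us sF]] nSk]; exists s; split=> // x; apply/idP/idP.
  by move/(allP sF).
move=> xF; apply: contra_notT nSk => xs; exists (x :: s).
by split; rewrite /= ?sk ?xs ?xF.
Qed.

End FiberCount.

(** * The equations and the fibers of the Gauss map *)

Section LogarithmicGradient.
Variables (K : fieldType) (d : nat).
Implicit Types x y b : 'rV[K]_d.+1.

Lemma pt_eq x y : x != 0 -> y != 0 -> pt x = pt y ->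
  exists2 c : K, c != 0 & x = c *: y.
Proof.
move=> x0 y0 e; have /vlineP[c xc] : x \in <[y]>%VS.
  by rewrite -val_pt // -e val_pt // memv_line.
by exists c => //; apply: contra_neq x0 => c0; rewrite xc c0 scale0r.
Qed.

Lemma meval_coord_prod x : (coord_prod K d).@[x 0] = \prod_i x 0 i.
Proof. by rewrite rmorph_prod /=; apply: eq_bigr => i _; rewrite mevalXU. Qed.

Lemma coord_prodE : coord_prod K d = 'X_[[multinom 1%N | i < d.+1]].
Proof. by rewrite mpolyXE_id; apply: eq_bigr => i _; rewrite mnmE. Qed.

Lemma coord_prod_homog : coord_prod K d \is d.+1.-homog.
Proof.
rewrite coord_prodE dhomogX /= mdegE; under eq_bigr => i _ do rewrite mnmE.
by rewrite sum1_card card_ord.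
Qed.

Lemma mderiv_coord_prod i : 'X_i * mderiv i (coord_prod K d) = coord_prod K d.
Proof.
rewrite coord_prodE mderivX mnmE scale1r -mpolyXD; congr 'X_[_].
by rewrite addmC submK //; apply/mnm_lepP => j; rewrite mnm1E mnmE; case: eqP.
Qed.

Lemma meval_linform b x : (linform b).@[x 0] = \sum_i b 0 i * x 0 i.
Proof.
rewrite rmorph_sum /=; apply: eq_bigr => i _.
by rewrite mevalZ mevalXU.
Qed.

Lemma dlog_coord_prodM (f : {mpoly K[d.+1]}) x i :
  (coord_prod K d * f).@[x 0] != 0 ->
  1 / x 0 i + (mderiv i f).@[x 0] / f.@[x 0] =
    (mderiv i (coord_prod K d * f)).@[x 0] / (coord_prod K d * f).@[x 0].
Proof.
rewrite mderivM mevalD !mevalM mulf_eq0 negb_or => /andP[P0 f0].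
have x0 : x 0 i != 0.
  apply: contra P0 => /eqP x0.
  by rewrite meval_coord_prod (bigD1 i) //= x0 mul0r.
have PE : (coord_prod K d).@[x 0] = x 0 i * (mderiv i (coord_prod K d)).@[x 0].
  by rewrite -[in LHS](mderiv_coord_prod i) mevalM mevalXU.
have D0 : (mderiv i (coord_prod K d)).@[x 0] != 0.
  by apply: contra P0; rewrite PE => /eqP ->; rewrite mulr0.
by rewrite PE; field; rewrite x0 f0 D0.
Qed.

(** Both conditions say that the gradient of F at x is proportional to b.  The
    factor N F(x) / L(x) and the equation of index 0 come from Euler's formula;
    here N must be invertible in K. *)
Lemma solutions_gauss_fiber n (f : {mpoly K[d.+1]}) b :
  (d + n + 1)%N%:R != 0 :> K -> f \is n.-homog -> b != 0 ->
  solutions n f b = gauss_fiber (coord_prod K d * f) (pt b).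
Proof.
set N := (d + n + 1)%N => N0 fh b0; set F := coord_prod K d * f.
have Fh : F \is N.-homog.
  by rewrite /N addn1 -addSn; apply: dhomogM => //; apply: coord_prod_homog.
apply/seteqP; split=> p.
  set x := hcoords p; move=> [].
  rewrite /D /= mevalM mulf_eq0 negb_or => /andP[F0 L0] sol; split=> //.
  have gradE i : i != 0 ->
      (mderiv i F).@[x 0] = N%:R * F.@[x 0] / (linform b).@[x 0] * b 0 i.
    move=> /sol; rewrite dlog_coord_prodM // => /eqP; rewrite subr_eq0 => /eqP e.
    rewrite -[LHS](divfK F0) e -!mulrA; congr (_ * _).
    by rewrite mulrC -mulrA mulrCA.
  set c := N%:R * F.@[x 0] / (linform b).@[x 0] in gradE.
  have c0 : c != 0 by rewrite !mulf_neq0 ?invr_eq0.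
  (* The terms of index i <> 0 of Euler's formula cancel. *)
  have grad0 : (mderiv 0 F).@[x 0] = c * b 0 0.
    have x0 : x 0 0 != 0.
      apply: contra F0; rewrite mevalM meval_coord_prod (bigD1 0) //= => /eqP ->.
      by rewrite !mul0r.
    have := euler x Fh.
    have -> : N%:R * F.@[x 0] = c * (linform b).@[x 0] by rewrite /c divfK.
    rewrite meval_linform mulr_sumr (bigD1 0) //= [RHS](bigD1 0) //=.
    rewrite [X in _ + X](eq_bigr (fun i => c * (b 0 i * x 0 i))); last first.
      by move=> i /gradE ->; rewrite mulrC mulrA.
    by move=> /addIr; rewrite mulrA [RHS]mulrC => /(mulfI x0).
  rewrite /= /gauss -(pt_scale c0 b0); congr pt; apply/rowP => i; rewrite !mxE.
  by have [->|/gradE] := eqVneq i 0.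
set x := hcoords p; case; rewrite /D /= => F0 gp.
have [c c0 gE] := pt_eq (grad_neq0 Fh N0 F0) b0 gp.
have gi i : (mderiv i F).@[x 0] = c * b 0 i.
  by move/rowP: gE => /(_ i); rewrite !mxE.
have NF : N%:R * F.@[x 0] = c * (linform b).@[x 0].
  rewrite -(euler x Fh) meval_linform mulr_sumr; apply: eq_bigr => i _.
  by rewrite gi mulrC mulrA.
have L0 : (linform b).@[x 0] != 0.
  by apply: contraNneq (mulf_neq0 N0 F0) => L0; rewrite NF L0 mulr0.
split; first by rewrite /D /= mevalM mulf_neq0.
move=> /= i _; rewrite dlog_coord_prodM // gi; apply/eqP; rewrite subr_eq0 mulrA.
by rewrite eqr_div // mulrAC -NF mulrAC.
Qed.

End LogarithmicGradient.

(** * Generic fibers of the Gauss map *)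

Section GenericFiber.
Variables (K : closedFieldType) (d : nat).
Implicit Types (x y : 'rV[K]_d.+1) (F G H : {mpoly K[d.+1]}).

Lemma zariski_open_D m G : G \is m.-homog -> zariski_open (D G).
Proof.
move=> hG; exists [set G]; split; first by move=> _ ->; exists m.
by rewrite bigcup_set1.
Qed.

Lemma zariski_dense_D m G : G \is m.-homog -> G != 0 -> zariski_dense (D G).
Proof.
move=> hG G0 V [S [hS ->]] [p [H SH Hp]].
have H0 : H != 0.
  by move: Hp; rewrite /D /=; apply: contraNneq => ->; rewrite meval0.
have [h hH] := hS H SH.
(* The factor 'X_0 keeps the point away from the origin. *)
have /meval_nonvanishing[v] : G * H * 'X_0 != 0.
  by rewrite !mulf_neq0 // -msize_poly_eq0 msizeX.
rewrite !mevalM mevalXU !mulf_eq0 !negb_or -andbA => /and3P[Gv Hv v0].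
have vE (p' : {mpoly K[d.+1]}) : p'.@[(\row_i v i) 0] = p'.@[v].
  by apply: meval_eq => i; rewrite mxE.
have x0 : \row_i v i != 0.
  by apply: contra v0 => /eqP/rowP/(_ 0); rewrite !mxE => ->.
exists (pt (\row_i v i)); split; first by apply/(D_pt hG); rewrite ?vE.
by exists H => //; apply/(D_pt hH); rewrite ?vE.
Qed.

(** Restricted to a line through the origin, H is a polynomial in the parameter c
    whose coefficients are the values at y of its homogeneous components, so any
    nonzero component G will do.  This passes from open sets of the affine space
    to open sets of the projective space, for properties that are invariant
    under scaling. *)
Lemma homogeneous_generic H : H != 0 -> exists m G,
  [/\ G \is m.-homog, G != 0 & forall y, G.@[y 0] != 0 ->
    exists2 c : K, c != 0 & H.@[(c *: y) 0] != 0].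
Proof.
move=> H0; have HE := pihomog_partitionE (leqnn (msize H)).
have [k Hk] : exists k : 'I_(msize H), pihomog mdeg k H != 0.
  apply/existsP; apply: contraNT H0 => /existsPn z; rewrite HE big1 // => k _.
  by apply/eqP; have := z k; rewrite negbK.
exists (k : nat), (pihomog mdeg k H); split=> //; first exact: pihomogP.
move=> y Hy; pose p := \poly_(j < msize H) (pihomog mdeg j H).@[y 0].
have p0 : p != 0.
  apply: contra Hy => /eqP/polyP/(_ k).
  by rewrite coef_poly ltn_ord coef0 => /eqP.
(* The factor 'X excludes c = 0. *)
have /closed_nonrootP[c] : p * 'X != 0 by rewrite mulf_neq0 ?polyX_eq0.
rewrite rootE hornerM hornerX mulf_eq0 negb_or => /andP[pc c0].
exists c => //; suff -> : H.@[(c *: y) 0] = p.[c] by [].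
rewrite {1}HE rmorph_sum horner_poly; apply: eq_bigr => j _ /=.
by rewrite (mevalZ_homog _ _ (pihomogP _ _ _)) mulrC.
Qed.

(** The logarithmic gradient grad F / F is homogeneous of degree -1, so each line
    of the fiber carries exactly one point where it equals y rather than a
    multiple of y. *)
Lemma gauss_fiberE m F y : F \is m.+1.-homog -> m.+1%:R != 0 :> K -> y != 0 ->
  let A := [set x | in_fiber F (fun i => mderiv i F) y x] in
  gauss_fiber F (pt y) = @pt K d @` A /\ {in A &, injective (@pt K d)}.
Proof.
move=> hF m0 y0; have fiberE x : in_fiber F (fun i => mderiv i F) y x <->
    F.@[x 0] != 0 /\ grad F x = F.@[x 0] *: y.
  rewrite /in_fiber; split=> [/andP[-> /forallP H]|[-> /rowP H]] /=.
    by split=> //; apply/rowP => i; rewrite !mxE (eqP (H i)) mulrC.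
  by apply/forallP => i; have := H i; rewrite !mxE mulrC => ->.
have nz x : F.@[x 0] != 0 -> x != 0.
  apply: contra_neq => ->; rewrite -(scale0r (0 : 'rV_d.+1)).
  by rewrite (mevalZ_homog _ _ hF) expr0n mul0r.
have gradZ c x : grad F (c *: x) = c ^+ m *: grad F x.
  by apply/rowP => i; rewrite !mxE (mevalZ_homog _ _ (mderiv_homog i hF)).
split.
  apply/seteqP; split=> [p [Fp gp]|_ [x /fiberE[Fx gx] <-]].
    set x := hcoords p in Fp gp.
    have [c c0 gE] := pt_eq (grad_neq0 hF m0 Fp) y0 gp.
    (* grad F (e x) / F (e x) = e^-1 (c y) / F (x), which is y for this e. *)
    pose e := c / F.@[x 0].
    have e0 : e != 0 by rewrite mulf_neq0 ?invr_eq0.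
    exists (e *: x); last by rewrite pt_scale ?nz // hcoordsK.
    apply/fiberE; rewrite (mevalZ_homog _ _ hF) mulf_neq0 ?expf_neq0 //.
    split=> //; rewrite gradZ gE scalerA exprSr -mulrA; congr (_ * _ *: _).
    by rewrite divfK.
  split; first exact/(D_pt hF (nz _ Fx)).
  by rewrite /= (gauss_pt hF) ?nz // gx pt_scale.
move=> x x'; rewrite !inE => /fiberE[Fx gx] /fiberE[Fx' gx'] e.
have [c c0 xE] := pt_eq (nz _ Fx) (nz _ Fx') e.
move: gx; rewrite xE gradZ gx' (mevalZ_homog _ _ hF) scalerA => /eqP.
rewrite -subr_eq0 -scalerBl scaler_eq0 (negPf y0) orbF subr_eq0 => /eqP.
move=> /(mulIf Fx'); rewrite exprS -{1}[c ^+ m]mul1r.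
by move=> /(mulIf (expf_neq0 m c0)) <-; rewrite scale1r.
Qed.

Lemma gauss_fiber_card m F y s : F \is m.+1.-homog -> m.+1%:R != 0 :> K ->
  y != 0 -> uniq s ->
  (forall x, (x \in s) = in_fiber F (fun i => mderiv i F) y x) ->
  gauss_fiber F (pt y) #= `I_(size s).
Proof.
move=> hF m0 y0 us sE; have [-> inj] := gauss_fiberE hF m0 y0.
pose g j := pt s`_j.
rewrite (_ : _ @` _ = g @` `I_(size s)); last first.
  apply/seteqP; split=> [_ [x /= xA <-]|_ [j /= js <-]].
    by exists (index x s); rewrite /g /= ?nth_index ?index_mem // sE.
  by exists s`_j => //=; rewrite -sE mem_nth.
apply: inj_card_eq => j l; rewrite !inE => js ls e.
have /eqP : s`_j = s`_l by apply: inj => //; rewrite inE /= -sE mem_nth.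
by rewrite nth_uniq // => /eqP.
Qed.

(** Once some generic cardinality exists, the dominant case holds by the choice
    made in the definition of the degree.  Otherwise the generic cardinality is
    0, since nonempty generic fibers would make the image dense. *)
Lemma generic_gauss_fiber_card m F : F \is m.+1.-homog -> m.+1%:R != 0 :> K ->
  generic_fiber_card F (gauss_degree F).
Proof.
move=> hF m0.
have [k gk] : exists k, generic_fiber_card F k.
  have [k [H H0 Hk]] := generic_fiber_count F (fun i => mderiv i F).
  have [h [G [hG G0 GH]]] := homogeneous_generic H0.
  exists k, (D G); split; first exact: zariski_open_D hG.
    exact: zariski_dense_D hG G0.
  move=> p /GH[c c0 /Hk[s [<- us sE]]].
  rewrite -[p]hcoordsK -(pt_scale c0) ?hcoords_neq0 //.
  apply: gauss_fiber_card hF m0 _ us sE.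
  by rewrite scaler_eq0 negb_or c0 hcoords_neq0.
rewrite /gauss_degree; case: asboolP => [dom|ndom].
  by apply: xgetPex; exists k.
case: k gk => [//|k] [U [Uo Ud Uk]]; case: ndom => V Vo V0.
have [y [Uy Vy]] := Ud V Vo V0; exists y; split=> //.
have /set0P[p [Fp py]] : gauss_fiber F y != set0.
  apply/eqP => fib0; have := Uk y Uy.
  by rewrite fib0 card_eq_sym card_eq0 => /eqP/seteqP[+ _] => /(_ 0%N); apply.
by exists p.
Qed.

End GenericFiber.

(** * The degree of the Gauss map counts the solutions *)

Theorem proposition5p4 (R : realType) (d n : nat) (f : {mpoly (R[i])[d.+1]})
    (f_neq0 : f != 0) (f_homog : f \is n.-homog) :
  exists U : set (proj R[i] d),
    [/\ zariski_open U, zariski_dense U &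
        forall b : 'rV[R[i]]_d.+1, b != 0 -> U (pt b) ->
          solutions n f b #= `I_(gauss_degree (coord_prod R[i] d * f))].
Proof.
have degE : (d + n + 1 = (d + n).+1)%N by rewrite addn1.
have N0 : (d + n).+1%:R != 0 :> R[i] by rewrite Num.Theory.pnatr_eq0.
have hF : coord_prod R[i] d * f \is (d + n).+1.-homog.
  by rewrite -addSn; apply: dhomogM f_homog; apply: coord_prod_homog.
have [U [Uo Ud Uk]] := generic_gauss_fiber_card hF N0.
exists U; split=> // b b0 Ub.
by rewrite solutions_gauss_fiber ?degE //; apply: Uk.
Qed.
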